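(* Let $\mathcal{A}(p;q)$ be a regular generalized Weyl algebra over $\mathbb{K}$ (as defined in the context), and let $\partial_0,\partial_+,\partial_-$ be the skew derivations of $\mathcal{A}(p;q)$ described in the context, with $\alpha_0,\alpha_+,\alpha_-\neq0$. Let $\Omega$ be the free left $\mathcal{A}(p;q)$-module with basis $\omega_-,\omega_0,\omega_+$, equipped with the right $\mathcal{A}(p;q)$-module structure determined by $\omega_i a:=\sigma_i(a)\omega_i$ for all $a\in\mathcal{A}(p;q)$, $i\in\{-,0,+\}$, and let $$d:\mathcal{A}(p;q)\to\Omega,\qquad d(a)=\partial_-(a)\omega_-+\partial_0(a)\omega_0+\partial_+(a)\omega_+.$$ If $q^2\neq1$ or $\deg(p(z))\le1$, then $(\Omega,d)$ is a first-order differential calculus on $\mathcal{A}(p;q)$.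
   Context: All algebras are associative and unital over a field $\mathbb{K}$ of characteristic $0$; $q\in\mathbb{K}$, $q\ne0$, and $p$ is a polynomial in one variable over $\mathbb{K}$. $p_{q^2}(z):=\frac{p(q^2z)-p(z)}{(q^2-1)z}$ is the $q^2$-derivative of $p$ (the usual formal derivative when $q^2=1$). The polynomial $p$ is $q^2$-separable if $p(z)$ is coprime with $zp_{q^2}(z)$. $\mathcal{A}(p;q)$ is the algebra generated by $x_+,x_-,z_+,z_-$ subject to the relations $$z_+z_-=z_-z_+,\quad x_+z_\pm=q^{-1}z_\pm x_+,\quad x_-z_\pm=q z_\pm x_-,\quad x_+x_-=p(z_+z_-),\quad x_-x_+=p(q^2z_-z_+).$$ It is called regular if $p$ is $q^2$-separable. It is $\mathbb{Z}$-graded by $|z_\pm|=|x_\pm|=\pm1$. Define algebra automorphisms of $\mathcal{A}(p;q)$ on homogeneous elements by $\sigma_\pm(a)=q^{|a|}a$, $\sigma_0(a)=q^{2|a|}a$. Put $z=z_+z_-$ and $c(z)=q\,p_{q^2}(z)$. For scalars $\alpha_0,\alpha_\pm\in\mathbb{K}$, the linear maps $\partial_i$, $i\in\{-,0,+\}$, are the skew $\sigma_i$-derivations of $\mathcal{A}(p;q)$ (i.e. $\partial_i(ab)=\partial_i(a)\sigma_i(b)+a\partial_i(b)$) given on generators by - $\partial_0(x_+)=\alpha_0x_+$, $\partial_0(x_-)=-q^{-2}\alpha_0x_-$, $\partial_0(z_+)=\alpha_0z_+$, $\partial_0(z_-)=-q^{-2}\alpha_0z_-$; - $\partial_-(x_+)=\partial_-(z_+)=0$,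 $\partial_-(x_-)=\alpha_-c(z)z_+$, $\partial_-(z_-)=\alpha_-x_+$; - $\partial_+(x_-)=\partial_+(z_-)=0$, $\partial_+(x_+)=\alpha_+c(z)z_-$, $\partial_+(z_+)=\alpha_+x_-$. A first-order differential calculus on an algebra $\mathcal{A}$ is an $\mathcal{A}$-bimodule $\Omega$ with a $\mathbb{K}$-linear map $d:\mathcal{A}\to\Omega$ such that (a) $d(ab)=d(a)b+ad(b)$ for all $a,b\in\mathcal{A}$, and (b) $\Omega=\mathcal{A}d(\mathcal{A})$, i.e. every $\omega\in\Omega$ is a finite sum $\sum_ia_id(b_i)$ with $a_i,b_i\in\mathcal{A}$. *)

(* Defs.v *)
From HB Require Import structures.
From mathcomp Require Import all_boot all_order all_algebra.
From mathcomp Require Import boolp ring.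

Set Implicit Arguments.
Unset Strict Implicit.
Unset Printing Implicit Defensive.
Import GRing.Theory.
Local Open Scope ring_scope.
Local Open Scope quotient_scope.

Section QDerivative.
Variables (K : fieldType) (q : K).

(* The division is exact: its dividend has no constant term. *)
Definition qderiv (p : {poly K}) : {poly K} :=
  if q ^+ 2 == 1 then p^`()
  else (p \Po (q ^+ 2 *: 'X) - p) %/ ((q ^+ 2 - 1) *: 'X).

Definition qseparable (p : {poly K}) : bool := coprimep p ('X * qderiv p).

End QDerivative.

(* A(p;q) is built as the quotient of the formal algebra expressions in four  *)
(* generators by the least congruence that contains the axioms of associative *)
(* unital K-algebras and the defining relations.                              *)
Inductive gwa_term (K : Type) : Type :=
  | TScal of K
  | TXp | TXm | TZp | TZm
  | TAdd of gwa_term K & gwa_term K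
  | TMul of gwa_term K & gwa_term K.

Arguments TXp {K}.
Arguments TXm {K}.
Arguments TZp {K}.
Arguments TZm {K}.

HB.instance Definition _ (K : Type) := gen_eqMixin (gwa_term K).
HB.instance Definition _ (K : Type) := gen_choiceMixin (gwa_term K).

(* Horner's scheme for p(t). *)
Definition tpoly (K : fieldType) (p : {poly K}) (t : gwa_term K) :
    gwa_term K :=
  foldr (fun c r => TAdd (TMul r t) (TScal c)) (TScal 0) p.

Section Congruence.
Variables (K : fieldType) (p : {poly K}) (q : K).
Implicit Types (r s t : gwa_term K) (k l : K).

Inductive gwa_cong : gwa_term K -> gwa_term K -> Prop :=
  | CRefl t : gwa_cong t t
  | CSym s t : gwa_cong s t -> gwa_cong t s
  | CTrans r s t : gwa_cong r s -> gwa_cong s t -> gwa_cong r t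
  | CAdd s s' t t' :
      gwa_cong s s' -> gwa_cong t t' -> gwa_cong (TAdd s t) (TAdd s' t')
  | CMul s s' t t' :
      gwa_cong s s' -> gwa_cong t t' -> gwa_cong (TMul s t) (TMul s' t')
  | CaddA r s t : gwa_cong (TAdd r (TAdd s t)) (TAdd (TAdd r s) t)
  | CaddC s t : gwa_cong (TAdd s t) (TAdd t s)
  | Cadd0 t : gwa_cong (TAdd (TScal 0) t) t
  | CaddN t : gwa_cong (TAdd (TMul (TScal (-1)) t) t) (TScal 0)
  | CmulA r s t : gwa_cong (TMul r (TMul s t)) (TMul (TMul r s) t)
  | Cmul1l t : gwa_cong (TMul (TScal 1) t) t
  | Cmul1r t : gwa_cong (TMul t (TScal 1)) t
  | CmulDl r s t :
      gwa_cong (TMul (TAdd r s) t) (TAdd (TMul r t) (TMul s t))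
  | CmulDr r s t :
      gwa_cong (TMul r (TAdd s t)) (TAdd (TMul r s) (TMul r t))
  | CscalD k l : gwa_cong (TScal (k + l)) (TAdd (TScal k) (TScal l))
  | CscalM k l : gwa_cong (TScal (k * l)) (TMul (TScal k) (TScal l))
  | CscalC k t : gwa_cong (TMul (TScal k) t) (TMul t (TScal k))
  | Czz : gwa_cong (TMul TZp TZm) (TMul TZm TZp)
  | Cxpzp : gwa_cong (TMul TXp TZp) (TMul (TScal q^-1) (TMul TZp TXp))
  | Cxpzm : gwa_cong (TMul TXp TZm) (TMul (TScal q^-1) (TMul TZm TXp))
  | Cxmzp : gwa_cong (TMul TXm TZp) (TMul (TScal q) (TMul TZp TXm))
  | Cxmzm : gwa_cong (TMul TXm TZm) (TMul (TScal q) (TMul TZm TXm))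
  | Cxpxm : gwa_cong (TMul TXp TXm) (tpoly p (TMul TZp TZm))
  | Cxmxp : gwa_cong (TMul TXm TXp)
      (tpoly p (TMul (TScal (q ^+ 2)) (TMul TZm TZp))).

Definition gwa_congb : rel (gwa_term K) := fun s t => `[< gwa_cong s t >].

Lemma gwa_congb_equiv : equiv_class_of gwa_congb.
Proof.
split=> [t|s t|s r t].
- by apply/asboolP; apply: CRefl.
- by apply/asboolP/asboolP; apply: CSym.
- by move=> /asboolP h1 /asboolP h2; apply/asboolP; apply: CTrans h1 h2.
Qed.

Canonical gwa_equiv := EquivRelPack gwa_congb_equiv.

Definition gwa : Type := {eq_quot gwa_equiv}.
HB.instance Definition _ := Choice.on gwa.
HB.instance Definition _ := EqQuotient.on gwa.

Definition cls (t : gwa_term K) : gwa := \pi_gwa t.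

Lemma clsP s t : cls s = cls t <-> gwa_cong s t.
Proof.
rewrite /cls; split=> [/eqmodP /asboolP //|h].
by apply/eqmodP/asboolP.
Qed.

Lemma cls_surj (a : gwa) : exists t, a = cls t.
Proof. by exists (repr a); rewrite /cls reprK. Qed.

Definition gadd (a b : gwa) : gwa := cls (TAdd (repr a) (repr b)).
Definition gmul (a b : gwa) : gwa := cls (TMul (repr a) (repr b)).
Definition gscal (k : K) : gwa := cls (TScal k).

Lemma cong_repr t : gwa_cong (repr (cls t)) t.
Proof. by apply/clsP; rewrite /cls reprK. Qed.

Lemma gaddE s t : gadd (cls s) (cls t) = cls (TAdd s t).
Proof. by apply/clsP; apply: CAdd; apply: cong_repr. Qed.

Lemma gmulE s t : gmul (cls s) (cls t) = cls (TMul s t).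
Proof. by apply/clsP; apply: CMul; apply: cong_repr. Qed.

Lemma gaddA : associative gadd.
Proof.
move=> a b c; have [r ->] := cls_surj a; have [s ->] := cls_surj b.
have [t ->] := cls_surj c; rewrite !gaddE; apply/clsP; exact: CaddA.
Qed.

Lemma gaddC : commutative gadd.
Proof.
move=> a b; have [r ->] := cls_surj a; have [s ->] := cls_surj b.
rewrite !gaddE; apply/clsP; exact: CaddC.
Qed.

Lemma gadd0 : left_id (gscal 0) gadd.
Proof.
by move=> a; have [r ->] := cls_surj a; rewrite gaddE; apply/clsP/Cadd0.
Qed.

Lemma gaddN : left_inverse (gscal 0) (gmul (gscal (-1))) gadd.
Proof.
move=> a; have [r ->] := cls_surj a; rewrite gmulE gaddE.
by apply/clsP/CaddN.
Qed.

HB.instance Definition _ := GRing.isZmodule.Build gwa gaddA gaddC gadd0 gaddN.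

Lemma gmulA : associative gmul.
Proof.
move=> a b c; have [r ->] := cls_surj a; have [s ->] := cls_surj b.
have [t ->] := cls_surj c; rewrite !gmulE; apply/clsP; exact: CmulA.
Qed.

Lemma gmul1l : left_id (gscal 1) gmul.
Proof.
by move=> a; have [r ->] := cls_surj a; rewrite gmulE; apply/clsP/Cmul1l.
Qed.

Lemma gmul1r : right_id (gscal 1) gmul.
Proof.
by move=> a; have [r ->] := cls_surj a; rewrite gmulE; apply/clsP/Cmul1r.
Qed.

Lemma gmulDl : left_distributive gmul gadd.
Proof.
move=> a b c; have [r ->] := cls_surj a; have [s ->] := cls_surj b.
have [t ->] := cls_surj c; rewrite !(gmulE, gaddE); apply/clsP; exact: CmulDl.
Qed.

Lemma gmulDr : right_distributive gmul gadd.
Proof.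
move=> a b c; have [r ->] := cls_surj a; have [s ->] := cls_surj b.
have [t ->] := cls_surj c; rewrite !(gmulE, gaddE); apply/clsP; exact: CmulDr.
Qed.

Lemma gscalC k (a : gwa) : gmul (gscal k) a = gmul a (gscal k).
Proof.
by have [r ->] := cls_surj a; rewrite !gmulE; apply/clsP/CscalC.
Qed.

Section Eval.
Variables (B : algType K) (xp xm zp zm : B).

Fixpoint teval (t : gwa_term K) : B :=
  match t with
  | TScal k => k%:A
  | TXp => xp | TXm => xm | TZp => zp | TZm => zm
  | TAdd s t => teval s + teval t
  | TMul s t => teval s * teval t
  end.

Lemma teval_poly t : teval (tpoly p t) = horner_alg (teval t) p.
Proof.
rewrite /horner_alg /horner_morph map_polyE horner_Poly /tpoly.
by elim: (p : seq K) => [|c s /= ->] //=; rewrite scale0r.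
Qed.

Definition gwa_relations : Prop :=
  [/\ zp * zm = zm * zp,
      xp * zp = q^-1 *: (zp * xp) /\ xp * zm = q^-1 *: (zm * xp),
      xm * zp = q *: (zp * xm) /\ xm * zm = q *: (zm * xm),
      xp * xm = horner_alg (zp * zm) p &
      xm * xp = horner_alg (q ^+ 2 *: (zm * zp)) p].

Lemma teval_cong s t :
  gwa_relations -> gwa_cong s t -> teval s = teval t.
Proof.
move=> [h1 [h2 h3] [h4 h5] h6 h7].
elim=> {s t} /=; rewrite ?teval_poly /= ?mulr_algl //.
- by move=> r s t _ -> _ ->.
- by move=> s s' t t' _ -> _ ->.
- by move=> s s' t t' _ -> _ ->.
- by move=> r s t; rewrite addrA.
- by move=> s t; rewrite addrC.
- by move=> t; rewrite scale0r add0r.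
- by move=> t; rewrite mulr_algl scaleN1r addNr scale0r.
- by move=> r s t; rewrite mulrA.
- by move=> t; rewrite mulr_algl scale1r.
- by move=> t; rewrite mulr_algr scale1r.
- by move=> r s t; rewrite mulrDl.
- by move=> r s t; rewrite mulrDr.
- by move=> k l; rewrite scalerDl.
- by move=> k l; rewrite mulr_algl scalerA.
- by move=> k t; rewrite mulr_algl mulr_algr.
Qed.

End Eval.

Lemma gwa_rel_point : @gwa_relations K^o p.[0] 1 0 0.
Proof.
have h (x : K^o) : horner_alg x p = p.[x].
  rewrite /horner_alg /horner_morph map_poly_id // => k _.
  by rewrite -[LHS]/(k * 1) mulr1.
by split; rewrite ?h ?(mulr0, mul0r, scaler0) ?mulr1 ?mul1r.
Qed.

Lemma gscal_neq0 : gscal 1 != gscal 0.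
Proof.
apply/eqP => /clsP /(teval_cong gwa_rel_point) /= /eqP.
by rewrite scale1r scale0r oner_eq0.
Qed.

HB.instance Definition _ :=
  GRing.Zmodule_isNzRing.Build gwa gmulA gmul1l gmul1r gmulDl gmulDr
    gscal_neq0.

(* Locked so that unification does not turn scalings into products. *)
Definition gscale (k : K) (a : gwa) : gwa := locked (gscal k * a).

Lemma gscaleE k a : gscale k a = gscal k * a.
Proof. by rewrite /gscale -lock. Qed.

Lemma gscaleA k l a : gscale k (gscale l a) = gscale (k * l) a.
Proof.
rewrite !gscaleE mulrA; congr (_ * a).
rewrite [LHS]gmulE; apply/esym/clsP; exact: CscalM.
Qed.

Lemma gscale1 : left_id 1 gscale.
Proof. by move=> a; rewrite gscaleE; apply: gmul1l. Qed.

Lemma gscaleDr : right_distributive gscale +%R.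
Proof. by move=> k a b; rewrite !gscaleE mulrDr. Qed.

Lemma gscaleDl a : {morph gscale^~ a : k l / k + l}.
Proof.
move=> k l; rewrite !gscaleE -mulrDl; congr (_ * a).
rewrite [RHS]gaddE; apply/clsP; exact: CscalD.
Qed.

HB.instance Definition _ :=
  GRing.Zmodule_isLmodule.Build K gwa gscaleA gscale1 gscaleDr gscaleDl.

Lemma gscaleAl (k : K) (a b : gwa) : k *: (a * b) = (k *: a) * b.
Proof. by rewrite -![_ *: _]/(gscale _ _) !gscaleE mulrA. Qed.

HB.instance Definition _ := GRing.Lmodule_isLalgebra.Build K gwa gscaleAl.

Lemma gscaleAr (k : K) (a b : gwa) : k *: (a * b) = a * (k *: b).
Proof.
rewrite -![_ *: _]/(gscale _ _) !gscaleE [LHS]mulrA [RHS]mulrA.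
by congr (_ * b); apply: gscalC.
Qed.

HB.instance Definition _ := GRing.Lalgebra_isAlgebra.Build K gwa gscaleAr.

Definition gwa_xp : gwa := cls TXp.
Definition gwa_xm : gwa := cls TXm.
Definition gwa_zp : gwa := cls TZp.
Definition gwa_zm : gwa := cls TZm.

Lemma teval_gwa t : teval gwa_xp gwa_xm gwa_zp gwa_zm t = cls t.
Proof.
elim: t => //= [k|s -> t ->|s -> t ->]; last exact: gmulE.
  by rewrite -[LHS]/(gscale k 1) gscaleE mulr1.
exact: gaddE.
Qed.

Lemma gwa_relP : gwa_relations gwa_xp gwa_xm gwa_zp gwa_zm.
Proof.
have E s t : gwa_cong s t ->
    teval gwa_xp gwa_xm gwa_zp gwa_zm s = teval gwa_xp gwa_xm gwa_zp gwa_zm t.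
  by move=> h; rewrite !teval_gwa; apply/clsP.
split; [exact: E Czz | split | split | | ].
- by have := E _ _ Cxpzp; rewrite /= mulr_algl.
- by have := E _ _ Cxpzm; rewrite /= mulr_algl.
- by have := E _ _ Cxmzp; rewrite /= mulr_algl.
- by have := E _ _ Cxmzm; rewrite /= mulr_algl.
- by have := E _ _ Cxpxm; rewrite teval_poly.
- by have := E _ _ Cxmxp; rewrite teval_poly /= mulr_algl.
Qed.

(* The universal property of the presentation. *)
Lemma gwa_lift (B : algType K) (xp xm zp zm : B) :
  gwa_relations xp xm zp zm ->
  exists f : {lrmorphism gwa -> B},
    [/\ f gwa_xp = xp, f gwa_xm = xm, f gwa_zp = zp & f gwa_zm = zm].
Proof.
move=> hB; pose f (a : gwa) := teval xp xm zp zm (repr a).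
have fE t : f (cls t) = teval xp xm zp zm t.
  exact/(teval_cong hB)/cong_repr.
have fB : zmod_morphism f.
  move=> a b; have [s ->] := cls_surj a; have [t ->] := cls_surj b.
  rewrite -[LHS]/(f (gadd _ (gmul _ _))) gmulE gaddE !fE /=.
  by rewrite mulr_algl scaleN1r.
have fM : monoid_morphism f.
  split=> [|a b]; first by rewrite -[LHS]/(f (cls (TScal 1))) fE /= scale1r.
  have [s ->] := cls_surj a; have [t ->] := cls_surj b.
  by rewrite -[LHS]/(f (gmul _ _)) gmulE !fE.
have fZ : scalable f.
  move=> k a; have [s ->] := cls_surj a.
  by rewrite -[_ *: _]/(gscale k _) gscaleE -[_ * _]/(gmul _ _) gmulE !fE /= mulr_algl.
pose m1 := GRing.isZmodMorphism.Build _ _ f fB.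
pose m2 := GRing.isMonoidMorphism.Build _ _ f fM.
pose m3 := GRing.isScalable.Build _ _ _ _ f fZ.
pose F : {lrmorphism gwa -> B} := HB.pack f m1 m2 m3.
by exists F; split; rewrite -[LHS]/(f (cls _)) fE.
Qed.

Lemma gwa_lift_unique (B : algType K) (f g : {lrmorphism gwa -> B}) :
  f gwa_xp = g gwa_xp -> f gwa_xm = g gwa_xm ->
  f gwa_zp = g gwa_zp -> f gwa_zm = g gwa_zm -> f =1 g.
Proof.
move=> h1 h2 h3 h4 a; have [t ->] := cls_surj a; rewrite -teval_gwa.
by elim: t => //= [k|s IHs t IHt|s IHs t IHt];
   rewrite ?rmorph_alg ?rmorphD ?rmorphM /= ?IHs ?IHt.
Qed.

(* gwa_homog n is the component of degree n, for |z_+| = |x_+| = 1 and        *)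
(* |z_-| = |x_-| = -1.                                                        *)
Inductive gwa_homog : int -> gwa -> Prop :=
  | Hscal k : gwa_homog 0 k%:A
  | Hxp : gwa_homog 1 gwa_xp
  | Hxm : gwa_homog (-1) gwa_xm
  | Hzp : gwa_homog 1 gwa_zp
  | Hzm : gwa_homog (-1) gwa_zm
  | HaddH n a b : gwa_homog n a -> gwa_homog n b -> gwa_homog n (a + b)
  | HmulH m n a b :
      gwa_homog m a -> gwa_homog n b -> gwa_homog (m + n) (a * b).

Definition degree_scaling (u : K) (s : gwa -> gwa) : Prop :=
  forall (n : int) a, gwa_homog n a -> s a = u ^ n *: a.

Definition skew_derivation (s d : gwa -> gwa) : Prop :=
  forall a b, d (a * b) = d a * s b + a * d b.

Local Notation x_p := gwa_xp.
Local Notation x_m := gwa_xm.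
Local Notation z_p := gwa_zp.
Local Notation z_m := gwa_zm.

(* c(z) with z = z_+ z_- *)
Definition gwa_c : gwa := horner_alg (z_p * z_m) (q *: qderiv q p).

Definition is_partial0 (al : K) (s d : gwa -> gwa) : Prop :=
  skew_derivation s d /\
  [/\ d x_p = al *: x_p, d x_m = - (q ^- 2 * al) *: x_m,
      d z_p = al *: z_p & d z_m = - (q ^- 2 * al) *: z_m].

Definition is_partialm (al : K) (s d : gwa -> gwa) : Prop :=
  skew_derivation s d /\
  [/\ d x_p = 0, d z_p = 0, d x_m = al *: (gwa_c * z_p) & d z_m = al *: x_p].

Definition is_partialp (al : K) (s d : gwa -> gwa) : Prop :=
  skew_derivation s d /\
  [/\ d x_m = 0, d z_m = 0, d x_p = al *: (gwa_c * z_m) & d z_p = al *: x_m].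

Definition gwa_Omega : Type := (gwa^o * gwa^o * gwa^o)%type.
HB.instance Definition _ := GRing.Lmodule.on gwa_Omega.

Definition omega_m : gwa_Omega := (1, 0, 0).
Definition omega_0 : gwa_Omega := (0, 1, 0).
Definition omega_p : gwa_Omega := (0, 0, 1).

(* (sum_i a_i omega_i) . a = sum_i a_i sigma_i(a) omega_i *)
Definition gwa_ract (sm s0 sp : gwa -> gwa) (w : gwa_Omega) (a : gwa) :
    gwa_Omega :=
  w.1.1 *: (sm a *: omega_m) + w.1.2 *: (s0 a *: omega_0)
    + w.2 *: (sp a *: omega_p).

Definition gwa_d (dm d0 dp : gwa -> gwa) (a : gwa) : gwa_Omega :=
  dm a *: omega_m + d0 a *: omega_0 + dp a *: omega_p.

(* The maps sigma_i and partial_i exist for every nonzero q and all scalars:  *)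
(* the predicates above can be satisfied.                                     *)
Section Existence.
Hypothesis q0 : q != 0.
Local Notation z := (z_p * z_m).

Lemma zpzm : z_p * z_m = z_m * z_p. Proof. by case: gwa_relP. Qed.
Lemma xpzp : x_p * z_p = q^-1 *: (z_p * x_p).
Proof. by case: gwa_relP => _ []. Qed.
Lemma xpzm : x_p * z_m = q^-1 *: (z_m * x_p).
Proof. by case: gwa_relP => _ []. Qed.
Lemma xmzp : x_m * z_p = q *: (z_p * x_m).
Proof. by case: gwa_relP => _ _ []. Qed.
Lemma xmzm : x_m * z_m = q *: (z_m * x_m).
Proof. by case: gwa_relP => _ _ []. Qed.
Lemma xpxm : x_p * x_m = horner_alg z p.
Proof. by case: gwa_relP. Qed.
Lemma xmxp : x_m * x_p = horner_alg (q ^+ 2 *: z) p.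
Proof. by rewrite zpzm; case: gwa_relP. Qed.

Lemma horner_alg_shift (x Z Z' : gwa) (f : {poly K}) :
  x * Z = Z' * x -> x * horner_alg Z f = horner_alg Z' f * x.
Proof.
move=> h; elim/poly_ind: f => [|f c IH]; first by rewrite !rmorph0 mulr0 mul0r.
rewrite !rmorphD !rmorphM /= !horner_algX !horner_algC mulrDr mulrDl.
by rewrite mulrA IH -!mulrA h mulr_algl mulr_algr.
Qed.

Lemma gwa_sigma_exists u : u != 0 ->
  exists s : {lrmorphism gwa -> gwa}, degree_scaling u s.
Proof.
move=> u0.
have sc k l (a b : gwa) : (k *: a) * (l *: b) = (k * l) *: (a * b).
  by rewrite -scalerAl -scalerAr scalerA.
have [|s [sxp sxm szp szm]] :=
  @gwa_lift gwa (u *: x_p) (u^-1 *: x_m) (u *: z_p) (u^-1 *: z_m).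
  split; rewrite !sc ?(mulfV u0, mulVf u0) ?scale1r.
  - exact: zpzm.
  - by rewrite xpzp xpzm !scalerA; split=> //; congr (_ *: _); rewrite mulrC.
  - by rewrite xmzp xmzm !scalerA; split=> //; congr (_ *: _); rewrite mulrC.
  - exact: xpxm.
  - by rewrite xmxp zpzm.
exists s => n a; elim=> {n a} [k||||| n a b _ IHa _ IHb|m n a b _ IHa _ IHb].
- by rewrite rmorph_alg expr0z scale1r.
- by rewrite sxp expr1z.
- by rewrite sxm exprN1.
- by rewrite szp expr1z.
- by rewrite szm exprN1.
- by rewrite rmorphD /= IHa IHb scalerDr.
- by rewrite rmorphM /= IHa IHb sc expfzDr.
Qed.

(* sum_i f_i [i]_l 'X^(i-1), where [i]_l = 1 + l + ... + l^(i-1) *)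
Definition qint_deriv (l : K) (f : {poly K}) : {poly K} :=
  \poly_(i < size f) (f`_i.+1 * \sum_(j < i.+1) l ^+ j).

Lemma coef_qint_deriv l f i :
  (qint_deriv l f)`_i = f`_i.+1 * \sum_(j < i.+1) l ^+ j.
Proof.
rewrite coef_poly; case: ltnP => // h.
by rewrite nth_default ?mul0r // ltnW // ltnS.
Qed.

Lemma qint_deriv0 l : qint_deriv l 0 = 0.
Proof. by apply/polyP=> i; rewrite coef_qint_deriv !coef0 mul0r. Qed.

Lemma qint_deriv_cons l f c :
  qint_deriv l (f * 'X + c%:P) = l *: ('X * qint_deriv l f) + f.
Proof.
apply/polyP=> i; rewrite !(coefE, coef_qint_deriv) /= addr0 big_ord_recl /=.
rewrite expr0 mulrDr mulr1 addrC; congr (_ + _).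
case: i => [|i]; first by rewrite big_ord0 !mulr0.
rewrite mulrCA /=; congr (_ * _); rewrite mulr_sumr.
by apply: eq_bigr => j _; rewrite /bump /= exprS.
Qed.

Lemma qint_derivX l f :
  qint_deriv l f * ((l - 1) *: 'X) = f \Po (l *: 'X) - f.
Proof.
elim/poly_ind: f => [|f c IH].
  by rewrite qint_deriv0 comp_poly0 mul0r subrr.
rewrite qint_deriv_cons comp_polyD comp_polyM comp_polyX comp_polyC.
rewrite -[f \Po _](subrK f) -IH -!mul_polyC; ring.
Qed.

Lemma qderivE f : qderiv q f = qint_deriv (q ^+ 2) f.
Proof.
rewrite /qderiv; case: eqVneq => [-> | h].
  apply/polyP=> i; rewrite coef_deriv coef_qint_deriv.
  under eq_bigr do rewrite expr1n.
  by rewrite sumr_const card_ord mulr_natr.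
have h' : q ^+ 2 - 1 != 0 by rewrite subr_eq0.
by rewrite -qint_derivX mulpK // scaler_eq0 negb_or h' polyX_eq0.
Qed.

Lemma qint_derivV l f : l != 0 ->
  qint_deriv l f \Po (l^-1 *: 'X) = qint_deriv l^-1 f.
Proof.
move=> l0; elim/poly_ind: f => [|f c IH]; first by rewrite !qint_deriv0 comp_poly0.
rewrite !qint_deriv_cons comp_polyD comp_polyZ comp_polyM comp_polyX IH.
rewrite -[f \Po _](subrK f) -qint_derivX -!mul_polyC polyCB polyC1.
have hl : l%:P * l^-1%:P = 1 :> {poly K} by rewrite -polyCM mulfV.
rewrite [l%:P * _](_ : _ = l%:P * l^-1%:P * ('X * qint_deriv l^-1 f)).
  by rewrite hl; ring.
by ring.
Qed.

Section SkewDerivation.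
Variables (s : {lrmorphism gwa -> gwa}) (vxp vxm vzp vzm : gwa).

Fixpoint dterm (t : gwa_term K) : gwa :=
  match t with
  | TScal _ => 0
  | TXp => vxp | TXm => vxm | TZp => vzp | TZm => vzm
  | TAdd t1 t2 => dterm t1 + dterm t2
  | TMul t1 t2 => dterm t1 * s (cls t2) + cls t1 * dterm t2
  end.

Lemma skew_derivation_exists :
  dterm (TMul TZp TZm) = dterm (TMul TZm TZp) ->
  dterm (TMul TXp TZp) = q^-1 *: dterm (TMul TZp TXp) ->
  dterm (TMul TXp TZm) = q^-1 *: dterm (TMul TZm TXp) ->
  dterm (TMul TXm TZp) = q *: dterm (TMul TZp TXm) ->
  dterm (TMul TXm TZm) = q *: dterm (TMul TZm TXm) ->
  dterm (TMul TXp TXm) = dterm (tpoly p (TMul TZp TZm)) ->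
  dterm (TMul TXm TXp) =
    dterm (tpoly p (TMul (TScal (q ^+ 2)) (TMul TZm TZp))) ->
  exists d : {linear gwa -> gwa}, skew_derivation s d /\
    [/\ d x_p = vxp, d x_m = vxm, d z_p = vzp & d z_m = vzm].
Proof.
have cM t1 t2 : cls (TMul t1 t2) = cls t1 * cls t2 by rewrite -gmulE.
have cD t1 t2 : cls (TAdd t1 t2) = cls t1 + cls t2 by rewrite -gaddE.
have cS k : cls (TScal k) = k%:A by rewrite -teval_gwa.
have dS k t : dterm (TMul (TScal k) t) = k *: dterm t.
  by rewrite /= mul0r add0r cS mulr_algl.
have dA t1 t2 : dterm (TAdd t1 t2) = dterm t1 + dterm t2 by [].
move=> h1 h2 h3 h4 h5 h6 h7.
have dC t1 t2 : gwa_cong t1 t2 -> dterm t1 = dterm t2.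
  elim=> {t1 t2}; rewrite ?dS //.
  - by move=> r t t' _ -> _ ->.
  - by move=> t t' u u' _ /= -> _ ->.
  - by move=> t t' u u' /clsP ht /= -> /clsP -> ->; rewrite ht.
  - by move=> r t u /=; rewrite addrA.
  - by move=> t u /=; rewrite addrC.
  - by move=> t /=; rewrite add0r.
  - by move=> t /=; rewrite mul0r add0r cS mulr_algl scaleN1r addNr.
  - by move=> r t u /=; rewrite !cM rmorphM mulrDl mulrDr !mulrA addrA.
  - by move=> t; rewrite dS scale1r.
  - by move=> t /=; rewrite mulr0 addr0 cS scale1r rmorph1 mulr1.
  - by move=> r t u /=; rewrite !cD !mulrDl addrACA.
  - by move=> r t u /=; rewrite !cD rmorphD !mulrDr addrACA.
  - by move=> k l /=; rewrite addr0.
  - by move=> k l /=; rewrite mul0r mulr0 addr0.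
  - by move=> k t; rewrite dS /= mulr0 addr0 cS rmorph_alg mulr_algr.
pose d (a : gwa) := dterm (repr a).
have dE t : d (cls t) = dterm t by apply/dC/cong_repr.
have dB : zmod_morphism d.
  move=> a b; have [t ->] := cls_surj a; have [u ->] := cls_surj b.
  rewrite -[LHS]/(d (gadd _ (gmul _ _))) gmulE gaddE !dE.
  by rewrite dA dS scaleN1r.
have dZ : scalable d.
  move=> k a; have [t ->] := cls_surj a.
  by rewrite -[_ *: _]/(gscale k _) gscaleE -[_ * _]/(gmul _ _) gmulE !dE dS.
pose m1 := GRing.isZmodMorphism.Build _ _ d dB.
pose m3 := GRing.isScalable.Build _ _ _ _ d dZ.
pose D : {linear gwa -> gwa} := HB.pack d m1 m3.
exists D; split=> [a b|]; last by split; rewrite -[LHS]/(d (cls _)) dE.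
have [t ->] := cls_surj a; have [u ->] := cls_surj b.
by rewrite -cM -![D _]/(d _) !dE.
Qed.

Lemma dterm_poly l t (f : {poly K}) :
  s (cls t) = cls t -> dterm t * cls t = l *: (cls t * dterm t) ->
  dterm (tpoly f t) = horner_alg (cls t) (qint_deriv l f) * dterm t.
Proof.
move=> h1 h2; rewrite -[X in horner_alg _ (_ _ X)](polyseqK f) /tpoly.
have cM t1 t2 : cls (TMul t1 t2) = cls t1 * cls t2 by rewrite -gmulE.
have cD t1 t2 : cls (TAdd t1 t2) = cls t1 + cls t2 by rewrite -gaddE.
have cS k : cls (TScal k) = k%:A by rewrite -teval_gwa.
elim: (f : seq K) => [|c r IH] /=; first by rewrite qint_deriv0 rmorph0 mul0r.
have -> : cls (foldr (fun c r => TAdd (TMul r t) (TScal c)) (TScal 0) r) =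
          horner_alg (cls t) (Poly r).
  elim: r {IH} => [|b r IH] /=; first by rewrite cS scale0r rmorph0.
  rewrite cD cM IH cS cons_poly_def rmorphD rmorphM /=.
  by rewrite horner_algX horner_algC.
rewrite IH h1 addr0 cons_poly_def qint_deriv_cons rmorphD mulrDl; congr (_ + _).
rewrite -mul_polyC !rmorphM /= horner_algC horner_algX mulr_algl -scalerAl.
rewrite -mulrA h2 -scalerAr (horner_alg_shift _ (erefl (cls t * cls t))).
by rewrite !mulrA.
Qed.

End SkewDerivation.

Lemma horner_alg_scale k (Z : gwa) f :
  horner_alg (k *: Z) f = horner_alg Z (f \Po (k *: 'X)).
Proof.
elim/poly_ind: f => [|f c IH]; first by rewrite comp_poly0 !rmorph0.
rewrite comp_polyD comp_polyM comp_polyX comp_polyC !rmorphD !rmorphM /=.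
by rewrite IH -mul_polyC !rmorphM /= !horner_algX !horner_algC mulr_algl.
Qed.
Lemma zp_z : z_p * z = z * z_p.
Proof. by rewrite -mulrA -zpzm. Qed.

Lemma zm_z : z_m * z = z * z_m.
Proof. by rewrite mulrA -zpzm. Qed.

Lemma xp_z : x_p * z = (q ^- 2 *: z) * x_p.
Proof.
rewrite mulrA xpzp -scalerAl -mulrA xpzm -scalerAr scalerA mulrA -scalerAl.
by rewrite -invfM -expr2.
Qed.

Lemma xm_z : x_m * z = (q ^+ 2 *: z) * x_m.
Proof.
rewrite mulrA xmzp -scalerAl -mulrA xmzm -scalerAr scalerA mulrA -scalerAl.
by rewrite -expr2.
Qed.

Lemma scale_gens u (s : gwa -> gwa) : degree_scaling u s ->
  [/\ s x_p = u *: x_p, s x_m = u^-1 *: x_m,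
      s z_p = u *: z_p & s z_m = u^-1 *: z_m].
Proof.
move=> hs; rewrite -exprN1 -[in X in X *: x_p](expr1z u).
rewrite -[in X in X *: z_p](expr1z u).
by split; apply: hs; do ?[exact: Hxp|exact: Hxm|exact: Hzp|exact: Hzm].
Qed.

Lemma horner_alg_qdiff :
  horner_alg (q ^+ 2 *: z) p - horner_alg z p =
  (q ^+ 2 - 1) *: (horner_alg z (qint_deriv (q ^+ 2) p) * z).
Proof.
rewrite horner_alg_scale -rmorphB -qint_derivX -mul_polyC !rmorphM /=.
by rewrite horner_algC horner_algX mulr_algl -scalerAr.
Qed.

Lemma gwa_cE : gwa_c = q *: horner_alg z (qint_deriv (q ^+ 2) p).
Proof.
by rewrite /gwa_c qderivE -mul_polyC rmorphM /= horner_algC mulr_algl.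
Qed.

Lemma cls_gens : [/\ cls TXp = x_p, cls TXm = x_m, cls TZp = z_p &
  cls TZm = z_m].
Proof. by []. Qed.

Lemma cls_zz : cls (TMul TZp TZm) = z.
Proof. by rewrite -gmulE. Qed.

Lemma cls_q2zz :
  cls (TMul (TScal (q ^+ 2)) (TMul TZm TZp)) = q ^+ 2 *: z.
Proof. by rewrite -!teval_gwa /= mulr_algl zpzm. Qed.

Lemma partialm_exists al (s : {lrmorphism gwa -> gwa}) :
  degree_scaling q s -> exists d : {linear gwa -> gwa}, is_partialm al s d.
Proof.
move=> /scale_gens [sxp sxm szp szm].
have q20 : q ^+ 2 != 0 by rewrite expf_neq0.
pose Q := qint_deriv (q ^+ 2) p.
have zpQ : z_p * horner_alg z Q = horner_alg z Q * z_p.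
  exact/horner_alg_shift/zp_z.
have zmQ : z_m * horner_alg z Q = horner_alg z Q * z_m.
  exact/horner_alg_shift/zm_z.
have zpxp : q *: (x_p * z_p) = z_p * x_p by rewrite xpzp scalerA mulfV ?scale1r.
have sz : s z = z.
  by rewrite rmorphM /= szp szm -scalerAl -scalerAr scalerA mulfV ?scale1r.
have wz : z_p * x_p * z = q ^- 2 *: (z * (z_p * x_p)).
  rewrite -mulrA xp_z -scalerAl -scalerAr; congr (_ *: _).
  by rewrite [LHS]mulrA zp_z; exact: esym (mulrA _ _ _).
have [E1 E2 E3 E4] := cls_gens.
have := @skew_derivation_exists s 0 (al *: (gwa_c * z_p)) 0 (al *: x_p).
case; rewrite ?[dterm _ _ _ _ _ (TMul _ _)]/= ?E1 ?E2 ?E3 ?E4 ?sxp ?sxm ?szp ?szm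
   ?(mul0r, mulr0) ?(add0r, addr0) ?scaler0 //.
- by rewrite -scalerAr -scalerAl -scalerAr zpxp.
- rewrite -scalerAr -scalerAl -scalerAr !scalerA; congr (_ *: _); by field.
- rewrite gwa_cE -/Q -!(scalerAl, scalerAr) !scalerA [z_p * (_ * _)]mulrA zpQ.
  by congr (_ *: _); ring.
- rewrite gwa_cE -/Q.
  have := horner_alg_qdiff; rewrite -xmxp -xpxm -/Q => /eqP.
  rewrite subr_eq => /eqP h.
  have f1 : horner_alg z Q * z_p * z_m = horner_alg z Q * z by rewrite -mulrA.
  have f2 : z_m * (horner_alg z Q * z_p) = horner_alg z Q * z.
    by rewrite mulrA zmQ -mulrA zpzm.
  rewrite -!(scalerAl, scalerAr) h f1 f2 !scalerDr !scalerA addrA -scalerDl.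
  by rewrite addrC; congr (_ *: _ + _ *: _); field.
- rewrite (dterm_poly (l := q ^- 2)) cls_zz //=; last first.
    by rewrite E3 E4 mul0r add0r -scalerAr -scalerAl wz !scalerA -scalerAr scalerA
      mulrC.
  rewrite -qint_derivV // -horner_alg_scale mul0r add0r E3 gwa_cE -/Q.
  rewrite -!(scalerAl, scalerAr) scalerA mulrA (horner_alg_shift _ xp_z).
  rewrite -mulrA xpzp -scalerAr scalerA; congr (_ *: _); by field.
- rewrite (dterm_poly (l := q ^- 2)) cls_q2zz /=
    ?mul0r ?add0r ?mulr0 ?addr0 -?teval_gwa /= ?mulr_algl.
  + rewrite horner_alg_scale -[X in X *: 'X]invrK qint_derivV ?invr_eq0 //.
    rewrite invrK szp -/Q gwa_cE -/Q.
    rewrite -!(scalerAl, scalerAr) xpzp -!(scalerAl, scalerAr) !scalerA.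
    by rewrite -[_ * z_p * x_p]mulrA; congr (_ *: _); field.
  + by rewrite linearZ /= sz.
  + rewrite szp -!(scalerAl, scalerAr) xpzp -!(scalerAl, scalerAr) wz -?(scalerAl, scalerAr) !scalerA.
    by congr (_ *: _); field.
- by move=> d [h [h1 h2 h3 h4]]; exists d.
Qed.

Lemma partialp_exists al (s : {lrmorphism gwa -> gwa}) :
  degree_scaling q s -> exists d : {linear gwa -> gwa}, is_partialp al s d.
Proof.
move=> /scale_gens [sxp sxm szp szm].
have q20 : q ^+ 2 != 0 by rewrite expf_neq0.
pose Q := qint_deriv (q ^+ 2) p.
have zpQ : z_p * horner_alg z Q = horner_alg z Q * z_p.
  exact/horner_alg_shift/zp_z.
have zmQ : z_m * horner_alg z Q = horner_alg z Q * z_m.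
  exact/horner_alg_shift/zm_z.
have zmxm : q^-1 *: (x_m * z_m) = z_m * x_m.
  by rewrite xmzm scalerA mulVf ?scale1r.
have sz : s z = z.
  by rewrite rmorphM /= szp szm -scalerAl -scalerAr scalerA mulfV ?scale1r.
have wz : z_m * x_m * z = q ^+ 2 *: (z * (z_m * x_m)).
  rewrite -mulrA xm_z -scalerAl -scalerAr; congr (_ *: _).
  by rewrite [LHS]mulrA zm_z; exact: esym (mulrA _ _ _).
have [E1 E2 E3 E4] := cls_gens.
have := @skew_derivation_exists s (al *: (gwa_c * z_m)) 0 (al *: x_m) 0.
case; rewrite ?[dterm _ _ _ _ _ (TMul _ _)]/= ?E1 ?E2 ?E3 ?E4 ?sxp ?sxm ?szp ?szm
   ?(mul0r, mulr0) ?(add0r, addr0) ?scaler0 //.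
- by rewrite -!(scalerAl, scalerAr) xmzm !scalerA; congr (_ *: _); field.
- rewrite gwa_cE -/Q.
  have := horner_alg_qdiff; rewrite -xmxp -xpxm -/Q => /eqP.
  rewrite subr_eq => /eqP h.
  have f1 : horner_alg z Q * z_m * z_p = horner_alg z Q * z.
    by rewrite -mulrA zpzm.
  have f2 : z_p * (horner_alg z Q * z_m) = horner_alg z Q * z.
    by rewrite mulrA zpQ -mulrA.
  rewrite -!(scalerAl, scalerAr) h f1 f2 !scalerDr !scalerA addrAC -scalerDl.
  by congr (_ *: _ + _ *: _); field.
- rewrite gwa_cE -/Q -!(scalerAl, scalerAr) !scalerA [z_m * (_ * _)]mulrA zmQ.
  by congr (_ *: _); ring.
- by rewrite -!(scalerAl, scalerAr) !scalerA; congr (_ *: _); field.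
- rewrite (dterm_poly (l := q ^+ 2)) cls_zz //=
    ?mul0r ?add0r ?mulr0 ?addr0 ?E1 ?E2 ?E3 ?E4.
    rewrite szm gwa_cE -/Q -!(scalerAl, scalerAr) xmzm -!(scalerAl, scalerAr).
    by rewrite !scalerA -[_ * z_m * x_m]mulrA; congr (_ *: _); field.
  rewrite szm -!(scalerAl, scalerAr) xmzm -!(scalerAl, scalerAr) wz.
  by rewrite -?(scalerAl, scalerAr) !scalerA; congr (_ *: _); field.
- rewrite (dterm_poly (l := q ^+ 2)) cls_q2zz /=
    ?mul0r ?add0r ?mulr0 ?addr0 -?teval_gwa /= ?mulr_algl.
  + rewrite horner_alg_scale gwa_cE -/Q -!(scalerAl, scalerAr).
    rewrite [x_m * _]mulrA (horner_alg_shift _ xm_z) horner_alg_scale.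
    rewrite -[_ * x_m * z_m]mulrA xmzm -!(scalerAl, scalerAr) !scalerA.
    by congr (_ *: _); field.
  + by rewrite linearZ /= sz.
  + rewrite -!(scalerAl, scalerAr) wz -?(scalerAl, scalerAr) !scalerA.
    by congr (_ *: _); field.
- by move=> d [h [h1 h2 h3 h4]]; exists d.
Qed.

Lemma partial0_exists al (s : {lrmorphism gwa -> gwa}) :
  degree_scaling (q ^+ 2) s ->
  exists d : {linear gwa -> gwa}, is_partial0 al s d.
Proof.
move=> /scale_gens [sxp sxm szp szm].
have q20 : q ^+ 2 != 0 by rewrite expf_neq0.
have [E1 E2 E3 E4] := cls_gens.
have sz : s z = z.
  by rewrite rmorphM /= szp szm -scalerAl -scalerAr scalerA mulfV ?scale1r.
have := @skew_derivation_exists s (al *: x_p) (- (q ^- 2 * al) *: x_m)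
   (al *: z_p) (- (q ^- 2 * al) *: z_m).
have e0 : al * q ^- 2 - q ^- 2 * al = 0 by field.
have e1 : - (q ^- 2 * al) * q ^+ 2 + al = 0 by field.
case; rewrite ?[dterm _ _ _ _ _ (TMul _ _)]/= ?E1 ?E2 ?E3 ?E4 ?sxp ?sxm ?szp
  ?szm -?(scalerAl, scalerAr) ?scalerA -?scalerDl ?e0 ?e1 ?scale0r ?scaler0 //.
- by rewrite xpzp !scalerA; congr (_ *: _); ring.
- by rewrite xmzm !scalerA; congr (_ *: _); field.
- rewrite (dterm_poly (l := 1)) cls_zz //= E3 E4 szm;
    rewrite -!(scalerAl, scalerAr) !scalerA -scalerDl e0 !scale0r.
    by rewrite mulr0.
  by rewrite mul0r mulr0 scaler0.
- rewrite (dterm_poly (l := 1)) cls_q2zz /= ?mul0r ?add0r -?teval_gwa /=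
    ?mulr_algl; last 2 first.
  + by rewrite linearZ /= sz.
  + rewrite szp -!(scalerAl, scalerAr) !scalerA -!scalerDl.
    by rewrite e1 !(scale0r, scaler0, mul0r, mulr0).
  rewrite szp -!(scalerAl, scalerAr) !scalerA -!scalerDl.
  by rewrite e1 !(scale0r, scaler0, mul0r, mulr0).
- by move=> d [h [h1 h2 h3 h4]]; exists d.
Qed.

End Existence.

End Congruence.

Section Calculus.
Variables (K : fieldType) (A : algType K) (Omega : lmodType A).
Variables (ract : Omega -> A -> Omega) (d : A -> Omega).

(* A bimodule is a left module with a compatible right action on which K acts *)
(* centrally.                                                                 *)
Record is_bimodule : Prop := IsBimodule {
  bimod_ractDl : forall v w a, ract (v + w) a = ract v a + ract w a;
  bimod_ractDr : forall w a b, ract w (a + b) = ract w a + ract w b;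
  bimod_ract1 : forall w, ract w 1 = w;
  bimod_ractM : forall w a b, ract w (a * b) = ract (ract w a) b;
  bimod_ractA : forall a w b, ract (a *: w) b = a *: ract w b;
  bimod_ractC : forall w (k : K), ract w k%:A = k%:A *: w
}.

Record is_fodc : Prop := IsFODC {
  fodc_bimodule : is_bimodule;
  fodc_linear : forall (k : K) a b, d (k *: a + b) = k%:A *: d a + d b;
  fodc_Leibniz : forall a b, d (a * b) = ract (d a) b + a *: d b;
  fodc_dense : forall w, exists s : seq (A * A),
    w = \sum_(ab <- s) ab.1 *: d ab.2
}.

End Calculus.

(* Main.v *)
Require Import Defs.
From HB Require Import structures.
From mathcomp Require Import all_boot all_order all_algebra.
From mathcomp Require Import ring.

Set Implicit Arguments.
Unset Strict Implicit.
Unset Printing Implicit Defensive.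
Import GRing.Theory.
Local Open Scope ring_scope.

(** Only the density of the exact forms needs an idea: that Omega is a bimodule
    and that d satisfies the Leibniz rule is read off coordinatewise from the
    twisted right action and the skew derivations.

    The left span S of the exact forms is also stable under the right action
    (exact_span_ract), so it suffices to show that the three basis forms lie in
    S. Write z = z_+ z_- and p' for the q^2-derivative of p. For a form w, the
    polynomials f with f(z) w in S form an ideal J of K[z], and w is in S as
    soon as 1 is in J. For w = omega_+ and w = omega_-, two elements of J come
    from eliminating omega_0:
    - multiplying dx_+ and dz_+ on the left, resp. dx_- and dz_-, cancels the
      omega_0 component and leaves a nonzero multiple of (z p' - p) omega_+,
      resp. of (z p' - p) omega_-;
    - z commutes with z_+ and z_-, so the commutator of dz_+, resp. dz_-, with
      z has no omega_0 component. Since z commutes with x_+ and x_- only up to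
      a factor q^(-2), resp. q^2, what remains is a multiple of
      z x_- omega_+, resp. z x_+ omega_-, that is nonzero if q^2 <> 1; hence
      z p is in J.
    Because p and z p' are coprime, z times 1 is a combination of z p and
    z (z p'), so z is in J, then p, and then 1 (qseparable_ideal1). If instead p
    has degree at most 1, then z p' - p is the constant -p(0), which is nonzero
    by separability.

    Once omega_- is in S, the differentials of z_- and x_- put z_- omega_0 and
    x_- omega_0 in S, hence z omega_0 and p(z) omega_0, and coprimality of p and
    z p' gives omega_0. *)

(** * Left combinations of exact forms *)

Section Span.
Variables (K : fieldType) (A : algType K) (Omega : lmodType A).
Variables (ract : Omega -> A -> Omega) (d : A -> Omega).

Definition exact_span (w : Omega) : Prop :=
  exists s : seq (A * A), w = \sum_(ab <- s) ab.1 *: d ab.2.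

Lemma exact_span_d a : exact_span (d a).
Proof. by exists [:: (1, a)]; rewrite big_seq1 scale1r. Qed.

Lemma exact_spanD v w : exact_span v -> exact_span w -> exact_span (v + w).
Proof. by move=> [s ->] [t ->]; exists (s ++ t); rewrite big_cat. Qed.

Lemma exact_spanZ a w : exact_span w -> exact_span (a *: w).
Proof.
move=> [s ->]; exists [seq (a * ab.1, ab.2) | ab <- s].
by rewrite big_map scaler_sumr; apply: eq_bigr => ab _; rewrite scalerA.
Qed.

Lemma exact_spanB v w : exact_span v -> exact_span w -> exact_span (v - w).
Proof.
by move=> Sv Sw; rewrite -scaleN1r; apply/exact_spanD/exact_spanZ.
Qed.

Hypothesis bimod : is_bimodule ract.
Hypothesis leibniz : forall a b, d (a * b) = ract (d a) b + a *: d b.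

(** Leibniz turns a right multiple of an exact form into left multiples of
    exact forms: (a db) c = a d(bc) - ab dc. *)
Lemma exact_span_ract w c : exact_span w -> exact_span (ract w c).
Proof.
have ract0 : ract 0 c = 0.
  by apply: (addrI (ract 0 c)); rewrite -bimod_ractDl // !addr0.
move=> [s ->]; elim: s => [|[a b] s IHs]; first by exists [::]; rewrite !big_nil.
rewrite big_cons (bimod_ractDl bimod); apply: exact_spanD => //=.
rewrite (bimod_ractA bimod); apply: exact_spanZ.
rewrite -[ract _ _](addrK (b *: d c)) -leibniz.
by apply: exact_spanB; [exact: exact_span_d | exact/exact_spanZ/exact_span_d].
Qed.

End Span.

(** * Separable polynomials *)

Section Separable.
Variables (K : fieldType) (q : K) (p : {poly K}).
Hypothesis psep : qseparable q p.

Lemma qseparable_bezout : exists u v, u * p + v * ('X * qderiv q p) = 1.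
Proof. by have /Bezout_eq1_coprimepP [[u v] /= e] := psep; exists u, v. Qed.

(** If p(0) = 0 then p and X times its q^2-derivative share the root 0. *)
Lemma qseparable_horner0 : p.[0] != 0.
Proof.
have [u [v /(congr1 (horner^~ 0))]] := qseparable_bezout.
rewrite hornerD !hornerM hornerX hornerC mul0r mulr0 addr0 => e.
by apply/eqP=> p0; move/eqP: e; rewrite p0 mulr0 eq_sym oner_eq0.
Qed.

Lemma qderiv_affine : (size p <= 2)%N -> 'X * qderiv q p - p = - (p.[0])%:P.
Proof.
move=> sp; have p0 i : p`_i.+2 = 0 by rewrite nth_default // (leq_trans sp).
have -> : qderiv q p = (p`_1)%:P.
  rewrite qderivE; apply/polyP=> -[|i]; rewrite coef_qint_deriv coefC /=.
    by rewrite big_ord1 expr0 mulr1.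
  by rewrite p0 mul0r.
apply/polyP=> -[|[|i]]; rewrite horner_coef0 coefB coefXM coefN !coefC /=.
- by rewrite sub0r.
- by rewrite subrr oppr0.
- by rewrite p0 subrr oppr0.
Qed.

(** J is an ideal. With u p + v X p' = 1, where p' is the q^2-derivative of p,
    X = u (X p) + v X (X p') and X p' = (X p' - p) + p show that J contains X,
    hence p, hence 1. In degree at most 1 the single generator X p' - p is
    already a nonzero constant. *)
Lemma qseparable_ideal1 (J : {poly K} -> Prop) :
  (forall f g, J f -> J g -> J (f + g)) -> (forall f g, J g -> J (f * g)) ->
  J ('X * qderiv q p - p) -> (q ^+ 2 != 1 -> J ('X * p)) ->
  q ^+ 2 != 1 \/ (size p <= 2)%N -> J 1.
Proof.
move=> JD JM Jg Jp [/Jp {}Jp | sp]; last first.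
  have := JM (- (p.[0])^-1)%:P _ Jg; rewrite qderiv_affine // polyCN mulrNN.
  by rewrite -polyCM mulVf ?qseparable_horner0.
have [u [v uv]] := qseparable_bezout.
have JX : J 'X.
  have -> : 'X = (u + v) * ('X * p) + (v * 'X) * ('X * qderiv q p - p).
    by rewrite -[LHS]mulr1 -uv; ring.
  by apply: JD; apply: JM.
have -> : 1 = - u * ('X * qderiv q p - p) + ((u + v) * qderiv q p) * 'X.
  by rewrite -uv; ring.
by apply: JD; apply: JM.
Qed.

End Separable.

(** * Coordinates on the free module of one-forms *)

Section FirstOrderCalculus.
Variables (K : fieldType) (q : K) (p : {poly K}).
Local Notation A := (gwa p q).
Local Notation x_p := (gwa_xp p q).
Local Notation x_m := (gwa_xm p q).
Local Notation z_p := (gwa_zp p q).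
Local Notation z_m := (gwa_zm p q).
Local Notation z := (z_p * z_m).
Local Notation h := (horner_alg z).

(** In coordinates the right action is twisted by one automorphism per slot;
    the casts keep the products in the algebra itself and not in its regular
    module, where the lemmas on K-scalings do not rewrite. *)
Lemma gwa_ractE (sm s0 sp : A -> A) w a :
  gwa_ract sm s0 sp w a =
    ((w.1.1 : A) * sm a, (w.1.2 : A) * s0 a, (w.2 : A) * sp a).
Proof.
rewrite /gwa_ract; congr (_, _, _);
  by rewrite /= /GRing.scale /= !(mulr1, mulr0, addr0, add0r).
Qed.

Lemma gwa_dE (dm d0 dp : A -> A) a :
  gwa_d dm d0 dp a = (dm a, d0 a, dp a).
Proof.
rewrite /gwa_d; congr (_, _, _);
  by rewrite /= /GRing.scale /= !(mulr1, mulr0, addr0, add0r).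
Qed.

Lemma scale_omega_p a : a *: omega_p p q = (0, 0, a).
Proof. by congr (_, _, _); rewrite /GRing.scale /= ?mulr0 ?mulr1. Qed.

Lemma scale_omega_m a : a *: omega_m p q = (a, 0, 0).
Proof. by congr (_, _, _); rewrite /GRing.scale /= ?mulr0 ?mulr1. Qed.

Lemma scale_omega_0 a : a *: omega_0 p q = (0, a, 0).
Proof. by congr (_, _, _); rewrite /GRing.scale /= ?mulr0 ?mulr1. Qed.

Lemma gwa_OmegaZ (a : A) (u v w : A) :
  a *: ((u, v, w) : gwa_Omega p q) = ((a * u : A), (a * v : A), (a * w : A)).
Proof. by []. Qed.

Lemma gwa_Omega_algZ (k : K) (u v w : A) :
  k%:A *: ((u, v, w) : gwa_Omega p q) =
    ((k *: u : A), (k *: v : A), (k *: w : A)).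
Proof. by rewrite gwa_OmegaZ !mulr_algl. Qed.

Lemma gwa_OmegaB (u v w u' v' w' : A) :
  (u, v, w) - (u', v', w') = (u - u', v - v', w - w') :> gwa_Omega p q.
Proof. by []. Qed.

Lemma horner_algXM f : h ('X * f) = z * h f.
Proof. by rewrite rmorphM /= horner_algX. Qed.

Lemma gwa_cZ : gwa_c p q = q *: h (qderiv q p).
Proof. by rewrite /gwa_c -mul_polyC rmorphM /= horner_algC mulr_algl. Qed.

(** x_- x_+ = p(q^2 z) in terms of the generators p and z p' of the separability
    condition: p(q^2 z) - p(z) = (q^2 - 1) z p'. *)
Lemma xmxp_qderiv :
  x_m * x_p = h p + (q ^+ 2 - 1) *: h ('X * qderiv q p).
Proof.
rewrite qderivE xmxp horner_algXM (horner_alg_shift _ (erefl (z * z))).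
by rewrite -horner_alg_qdiff addrC subrK.
Qed.

(** This reduces equalities of scaled elements to scalars up to conversion,
    where the two scalings may carry different instances of one structure. *)
Lemma eq_scale (k l : K) (a : A) : k = l -> k *: a = l *: a.
Proof. by move=> ->. Qed.

(** z has degree 0. *)
Lemma degree_scaling_z u (s : {lrmorphism A -> A}) :
  u != 0 -> degree_scaling u s -> s z = z.
Proof.
move=> u0 /scale_gens [_ _ szp szm].
by rewrite rmorphM /= szp szm -scalerAl -scalerAr scalerA mulfV ?scale1r.
Qed.

Lemma gwa_ract_bimodule (sm s0 sp : {lrmorphism A -> A}) :
  is_bimodule (gwa_ract sm s0 sp).
Proof.
split.
- by move=> v w a; rewrite !gwa_ractE !mulrDl.
- by move=> w a b; rewrite !gwa_ractE !rmorphD !mulrDr.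
- by move=> [[a b] c]; rewrite gwa_ractE !rmorph1 !mulr1.
- by move=> w a b; rewrite !gwa_ractE !rmorphM !mulrA.
- by move=> a w b; rewrite !gwa_ractE; congr (_, _, _); rewrite -[LHS]mulrA.
- move=> [[a b] c] k; rewrite gwa_ractE !rmorph_alg.
  by congr (_, _, _); rewrite [LHS]mulr_algr -[LHS]mulr_algl.
Qed.

(** * Every form is a left combination of exact forms *)

Variables (sm s0 sp : {lrmorphism A -> A}).
Variables (am a0 ap : K).
Variables (dm d0 dp : {linear A -> A}).
Hypotheses (q0 : q != 0) (psep : qseparable q p).
Hypotheses (hsm : degree_scaling q sm) (hs0 : degree_scaling (q ^+ 2) s0)
  (hsp : degree_scaling q sp).
Hypotheses (am_neq0 : am != 0) (a0_neq0 : a0 != 0) (ap_neq0 : ap != 0).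
Hypotheses (hdm : is_partialm am sm dm) (hd0 : is_partial0 a0 s0 d0)
  (hdp : is_partialp ap sp dp).
Local Notation ract := (gwa_ract sm s0 sp).
Local Notation d := (gwa_d dm d0 dp).
Local Notation spanned := (exact_span d).

Lemma gwa_d_linear (k : K) a b : d (k *: a + b) = k%:A *: d a + d b.
Proof.
rewrite !gwa_dE !linearP; congr (_, _, _); congr (_ + _);
  by rewrite -[LHS]mulr_algl.
Qed.

Lemma gwa_d_leibniz a b : d (a * b) = ract (d a) b + a *: d b.
Proof.
have [[hm _] [h0 _] [hp _]] := And3 hdm hd0 hdp.
by rewrite gwa_ractE !gwa_dE hm h0 hp.
Qed.

Lemma exact_ract w a : spanned w -> spanned (ract w a).
Proof. apply: exact_span_ract; [exact: gwa_ract_bimodule|exact: gwa_d_leibniz]. Qed.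

Lemma d_xp : d x_p = (0, a0 *: x_p, (ap * q) *: (h (qderiv q p) * z_m)).
Proof.
have [[_ [e1 _ _ _]] [_ [e2 _ _ _]] [_ [_ _ e3 _]]] := And3 hdm hd0 hdp.
by rewrite gwa_dE e1 e2 e3 gwa_cZ -scalerAl scalerA.
Qed.

Lemma d_xm :
  d x_m = ((am * q) *: (h (qderiv q p) * z_p), - (q ^- 2 * a0) *: x_m, 0).
Proof.
have [[_ [_ _ e1 _]] [_ [_ e2 _ _]] [_ [e3 _ _ _]]] := And3 hdm hd0 hdp.
by rewrite gwa_dE e1 e2 e3 gwa_cZ -scalerAl scalerA.
Qed.

Lemma d_zp : d z_p = (0, a0 *: z_p, ap *: x_m).
Proof.
have [[_ [_ e1 _ _]] [_ [_ _ e2 _]] [_ [_ _ _ e3]]] := And3 hdm hd0 hdp.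
by rewrite gwa_dE e1 e2 e3.
Qed.

Lemma d_zm : d z_m = (am *: x_p, - (q ^- 2 * a0) *: z_m, 0).
Proof.
have [[_ [_ _ _ e1]] [_ [_ _ _ e2]] [_ [_ e3 _ _]]] := And3 hdm hd0 hdp.
by rewrite gwa_dE e1 e2 e3.
Qed.

Lemma spannedZ_inj k w : k != 0 -> spanned (k%:A *: w) -> spanned w.
Proof.
move=> k0 /(exact_spanZ (k^-1)%:A).
by rewrite scalerA mulr_algl scalerA mulVf // !scale1r.
Qed.

(** The polynomials f with f(z) w in the span form an ideal, so finding two
    elements of it suffices; the hypotheses are those that elimination of
    omega_0 produces. *)
Lemma spanned_of_ideal w :
  spanned (h ('X * qderiv q p - p) *: w) ->
  (q ^+ 2 != 1 -> spanned (h ('X * p) *: w)) ->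
  q ^+ 2 != 1 \/ (size p <= 2)%N -> spanned w.
Proof.
move=> hg hp hc; rewrite -[w]scale1r -[1](rmorph1 h).
apply: (qseparable_ideal1 psep (J := fun f => spanned (h f *: w))) => //.
- by move=> f g; rewrite rmorphD scalerDl; exact: exact_spanD.
- by move=> f g; rewrite rmorphM -scalerA; exact: exact_spanZ.
Qed.

Hypothesis hc : q ^+ 2 != 1 \/ (size p <= 2)%N.

(** Both steps eliminate omega_0: the first because z_+ x_+ = q x_+ z_+, the
    second because z and z_+ commute. *)
Lemma exact_omega_p : spanned (omega_p p q).
Proof.
apply: spanned_of_ideal hc => [|q21].
  apply: (@spannedZ_inj (ap * q)); first by rewrite mulf_neq0.
  have -> : (ap * q)%:A *: (h ('X * qderiv q p - p) *: omega_p p q) =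
    z_p *: d x_p - (q *: x_p) *: d z_p.
    rewrite scale_omega_p gwa_Omega_algZ d_xp d_zp !gwa_OmegaZ gwa_OmegaB.
    congr (_, _, _); rewrite ?mulr0 ?scaler0 ?subrr // -!(scalerAl, scalerAr).
      by rewrite xpzp !scalerA mulrAC mulfV // mul1r subrr.
    rewrite xpxm [z_p * (_ * z_m)]mulrA (horner_alg_shift _ (zp_z p q)) -mulrA.
    rewrite -(horner_alg_shift _ (erefl (z * z))) -horner_algXM.
    by rewrite scalerA [q * ap]mulrC -scalerBr -rmorphB.
  apply: exact_spanB; exact/exact_spanZ/exact_span_d.
(* The commutator is ap (q^2 - 1) z x_- omega_+, and x_+ z = q^(-2) z x_+. *)
apply: (@spannedZ_inj (ap * (1 - q ^- 2))).
  by rewrite mulf_neq0 // subr_eq0 eq_sym invr_eq1.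
have -> : (ap * (1 - q ^- 2))%:A *: (h ('X * p) *: omega_p p q) =
  x_p *: (ract (d z_p) z - z *: d z_p).
  have sz := degree_scaling_z q0 hsp.
  have s0z := degree_scaling_z (expf_neq0 2 q0) hs0.
  rewrite scale_omega_p gwa_Omega_algZ gwa_ractE d_zp /= sz s0z.
  rewrite [_ *: (0, _, _)]gwa_OmegaZ gwa_OmegaB gwa_OmegaZ.
  congr (_, _, _); rewrite ?(scaler0, mul0r, mulr0, subrr) //.
    by rewrite -!(scalerAl, scalerAr) zp_z subrr mulr0.
  rewrite -!(scalerAl, scalerAr) xm_z -scalerAl -scalerBr -scalerAr.
  rewrite -{2}[z * x_m]scale1r -scalerBl -scalerAr [x_p * _]mulrA xp_z.
  rewrite -!scalerAl -[z * x_p * x_m]mulrA xpxm -horner_algXM !scalerA.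
  by apply: eq_scale; field.
apply/exact_spanZ/exact_spanB; last exact/exact_spanZ/exact_span_d.
exact/exact_ract/exact_span_d.
Qed.

(** As for omega_+, with z_- x_- = q^(-1) x_- z_-. Here x_- x_+ = p(q^2 z)
    replaces x_+ x_- = p(z), and the extra (q^2 - 1) z p' turns the coefficient
    q of z p' into q^(-1). *)
Lemma exact_omega_m : spanned (omega_m p q).
Proof.
have [_ sxm _ _] := scale_gens hsm.
apply: spanned_of_ideal hc => [|q21].
  apply: (@spannedZ_inj (am * q^-1)); first by rewrite mulf_neq0 ?invr_eq0.
  have -> : (am * q^-1)%:A *: (h ('X * qderiv q p - p) *: omega_m p q) =
    z_m *: d x_m - (q^-1 *: x_m) *: d z_m.
    rewrite scale_omega_m gwa_Omega_algZ d_xm d_zm !gwa_OmegaZ gwa_OmegaB.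
    congr (_, _, _); rewrite ?mulr0 ?scaler0 ?subrr // -!(scalerAl, scalerAr).
      rewrite xmxp_qderiv [z_m * (_ * z_p)]mulrA.
      rewrite (horner_alg_shift _ (zm_z p q)) -mulrA.
      rewrite -zpzm -(horner_alg_shift _ (erefl (z * z))) -horner_algXM.
      rewrite rmorphB /= scalerBr [q^-1 *: _]scalerA scalerDr opprD.
      rewrite addrA addrAC scalerA -scalerBl.
      rewrite [q^-1 * am]mulrC.
      by have -> : am * q - am / q * (q ^+ 2 - 1) = am / q by field.
    rewrite xmzm !scalerA; apply/eqP; rewrite eq_sym subr_eq0; apply/eqP.
    by apply: eq_scale; field.
  apply: exact_spanB; exact/exact_spanZ/exact_span_d.
(* The commutator is a multiple of z x_+ omega_-. Multiplying by x_- from the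
   right, at the cost of a factor q^(-1), gives z p(z); from the left it would
   give z p(q^2 z). *)
apply: (@spannedZ_inj (am * (q ^- 2 - 1) * q^-1)).
  by rewrite !mulf_neq0 ?invr_eq0 // subr_eq0 invr_eq1.
have -> : (am * (q ^- 2 - 1) * q^-1)%:A *: (h ('X * p) *: omega_m p q) =
  ract (ract (d z_m) z - z *: d z_m) x_m.
  have sz := degree_scaling_z q0 hsm.
  have s0z := degree_scaling_z (expf_neq0 2 q0) hs0.
  rewrite scale_omega_m gwa_Omega_algZ d_zm [gwa_ract _ _ _ _ z]gwa_ractE.
  rewrite [_ *: (_, _, 0)]gwa_OmegaZ gwa_OmegaB gwa_ractE /= sz s0z sxm.
  congr (_, _, _); rewrite ?(scaler0, mul0r, mulr0, subrr) //.
    rewrite -!(scalerAl, scalerAr) xp_z -scalerAl -scalerBr -scalerAl.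
    rewrite -{2}[z * x_p]scale1r -scalerBl -scalerAl.
    rewrite -[z * x_p * x_m]mulrA xpxm -horner_algXM.
    by rewrite !scalerA; apply: eq_scale; field.
  by rewrite -!(scalerAl, scalerAr) zm_z subrr mul0r.
apply/exact_ract/exact_spanB; last exact/exact_spanZ/exact_span_d.
exact/exact_ract/exact_span_d.
Qed.

(** Since omega_- is available, dz_- and dx_- yield z_- omega_0 and x_- omega_0;
    multiplication by z_+ and x_+ then gives z omega_0 and p(z) omega_0. *)
Lemma exact_omega_0 : spanned (omega_0 p q).
Proof.
have k0 : - (q ^- 2 * a0) != 0.
  by rewrite oppr_eq0 mulf_neq0 // invr_eq0 expf_neq0.
have Hz : spanned (z_m *: omega_0 p q).
  apply: (spannedZ_inj k0).
  have -> : (- (q ^- 2 * a0))%:A *: (z_m *: omega_0 p q) =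
    d z_m - (am *: x_p) *: omega_m p q.
    rewrite scale_omega_m scale_omega_0 d_zm gwa_Omega_algZ.
    by rewrite scaler0 gwa_OmegaB !subrr !subr0.
  apply: exact_spanB; [exact: exact_span_d | exact/exact_spanZ/exact_omega_m].
have Hx : spanned (x_m *: omega_0 p q).
  apply: (spannedZ_inj k0).
  have -> : (- (q ^- 2 * a0))%:A *: (x_m *: omega_0 p q) =
    d x_m - ((am * q) *: (h (qderiv q p) * z_p)) *: omega_m p q.
    rewrite scale_omega_m scale_omega_0 d_xm gwa_Omega_algZ.
    by rewrite scaler0 gwa_OmegaB !subrr !subr0.
  apply: exact_spanB; [exact: exact_span_d | exact/exact_spanZ/exact_omega_m].
have [u [v uv]] := qseparable_bezout psep.
rewrite -[omega_0 _ _]scale1r -[1](rmorph1 h) -uv rmorphD !rmorphM /=.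
rewrite horner_algX [z * h _](horner_alg_shift _ (erefl (z * z))) -xpxm.
rewrite scalerDl !mulrA -![(_ * _) *: _]scalerA.
by apply: exact_spanD; do ?[exact: Hz | exact: Hx | apply: exact_spanZ].
Qed.

Lemma exact_span_full w : spanned w.
Proof.
have -> : w = w.1.1 *: omega_m p q + w.1.2 *: omega_0 p q + w.2 *: omega_p p q.
  rewrite scale_omega_m scale_omega_0 scale_omega_p; case: w => [[a b] c].
  by congr (_, _, _); rewrite /= ?addr0 ?add0r.
do ?apply: exact_spanD; apply: exact_spanZ.
- exact: exact_omega_m.
- exact: exact_omega_0.
- exact: exact_omega_p.
Qed.

End FirstOrderCalculus.

(** * The calculus *)

Theorem theorem4p2 (K : fieldType) (charK : [pchar K] =i pred0)
    (q : K) (hq : q != 0) (p : {poly K}) (hp : qseparable q p)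
    (sm s0 sp : {lrmorphism gwa p q -> gwa p q})
    (hsm : degree_scaling q sm) (hs0 : degree_scaling (q ^+ 2) s0)
    (hsp : degree_scaling q sp)
    (am a0 ap : K) (ham : am != 0) (ha0 : a0 != 0) (hap : ap != 0)
    (dm d0 dp : {linear gwa p q -> gwa p q})
    (hdm : is_partialm am sm dm) (hd0 : is_partial0 a0 s0 d0)
    (hdp : is_partialp ap sp dp) :
  q ^+ 2 != 1 \/ (size p <= 2)%N ->
  is_fodc (gwa_ract sm s0 sp) (gwa_d dm d0 dp).
Proof.
move=> hc; split.
- exact: gwa_ract_bimodule.
- exact: gwa_d_linear.
- exact: gwa_d_leibniz hdm hd0 hdp.
- exact: exact_span_full hq hp hsm hs0 hsp ham ha0 hap hdm hd0 hdp hc.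
Qed.
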